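(* Let $n$ be a positive integer, let $A\in\mathbb R^{n\times n}$ be a constant matrix, and let $g:\mathbb R\to\mathbb R^n$ be a function. Consider the linear system of ordinary differential equations $$x'(t)=Ax(t)+g(t),\qquad x\in\mathbb R^n,\ t\in\mathbb R.$$ If all eigenvalues of $A$ have nonzero real parts and the function $g$ is unpredictable, then the system possesses a unique unpredictable solution. If, additionally, all eigenvalues of $A$ have negative real parts, then the unpredictable solution is uniformly asymptotically stable.
   Context: $\|\cdot\|$ denotes the Euclidean norm for vectors. A uniformly continuous and bounded function $\vartheta:\mathbb R\to\mathbb R^m$ is called unpredictable if there exist positive numbers $\epsilon_0,\delta$ and sequences $\{t_n\},\{u_n\}$ of real numbers, both of which diverge to infinity, such that (i) $\|\vartheta(t+t_n)-\vartheta(t)\|\to 0$ as $n\to\infty$ uniformly on compact subsets of $\mathbb R$, and (ii) $\|\vartheta(t+t_n)-\vartheta(t)\|\ge\epsilon_0$ for each $t\in[u_n-\delta,u_n+\delta]$ and each $n\in\mathbb N$. An unpredictable solution of the system is a solution defined on all of $\mathbb R$ which is an unpredictable function. *)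

(* Defs.v *)
From HB Require Import structures.
From mathcomp Require Import all_boot all_order all_algebra.
From mathcomp Require Import all_classical all_reals all_analysis.
From mathcomp Require Import complex.

Set Implicit Arguments.
Unset Strict Implicit.
Unset Printing Implicit Defensive.

Import Order.TTheory GRing.Theory Num.Theory.
Import numFieldNormedType.Exports.

Local Open Scope classical_set_scope.
Local Open Scope ring_scope.

(* The norm `|v| of the library on matrices is the sup norm, which would give
   different constants in the definitions below. *)
Definition enorm (R : realType) (n : nat) (v : 'cV[R]_n) : R :=
  Num.sqrt (\sum_(i < n) v i 0 ^+ 2).

Definition unpredictable (R : realType) (n : nat) (f : R -> 'cV[R]_n) : Prop :=
  [/\ forall e : R, 0 < e -> exists2 d : R, 0 < d &
        forall s t : R, `|s - t| < d -> enorm (f s - f t) < e,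
      exists M : R, forall t : R, enorm (f t) <= M &
      exists (eps0 delta : R) (t_ u_ : R^nat),
        [/\ 0 < eps0 /\ 0 < delta,
            t_ @ \oo --> +oo /\ u_ @ \oo --> +oo,
            {family compact,
              (fun (k : nat) (t : R) => enorm (f (t + t_ k) - f t)) @ \oo
                --> (fun _ : R => 0 : R)} &
            forall (k : nat) (t : R), u_ k - delta <= t <= u_ k + delta ->
              eps0 <= enorm (f (t + t_ k) - f t)]].

Definition solution (R : realType) (n : nat) (A : 'M[R]_n)
    (g x : R -> 'cV[R]_n) : Prop :=
  forall t : R, is_derive t (1 : R) x (A *m x t + g t).

(* Solutions on [t0, +oo[; the values of x on the left of t0 are irrelevant.
   When g is continuous, continuity at t0 makes the right derivative at t0
   exist and satisfy the equation. *)
Definition forward_solution (R : realType) (n : nat) (A : 'M[R]_n)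
    (g : R -> 'cV[R]_n) (t0 : R) (x : R -> 'cV[R]_n) : Prop :=
  x t @[t --> t0^'+] --> x t0 /\
  forall t : R, t0 < t -> is_derive t (1 : R) x (A *m x t + g t).

Definition unpredictable_solution (R : realType) (n : nat) (A : 'M[R]_n)
    (g x : R -> 'cV[R]_n) : Prop :=
  solution A g x /\ unpredictable x.

Definition uniformly_stable (R : realType) (n : nat) (A : 'M[R]_n)
    (g x : R -> 'cV[R]_n) : Prop :=
  forall e : R, 0 < e -> exists2 d : R, 0 < d &
    forall (t0 : R) (y : R -> 'cV[R]_n), forward_solution A g t0 y ->
      enorm (y t0 - x t0) < d ->
      forall t : R, t0 <= t -> enorm (y t - x t) < e.

Definition uniformly_attractive (R : realType) (n : nat) (A : 'M[R]_n)
    (g x : R -> 'cV[R]_n) : Prop :=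
  exists2 c : R, 0 < c &
    forall e : R, 0 < e -> exists2 T : R, 0 < T &
      forall (t0 : R) (y : R -> 'cV[R]_n), forward_solution A g t0 y ->
        enorm (y t0 - x t0) < c ->
        forall t : R, t0 + T <= t -> enorm (y t - x t) < e.

Definition uniformly_asymptotically_stable (R : realType) (n : nat)
    (A : 'M[R]_n) (g x : R -> 'cV[R]_n) : Prop :=
  uniformly_stable A g x /\ uniformly_attractive A g x.

(* The complex eigenvalues of a real matrix; the library's [eigenvalue] only
   sees those lying in the base field of the matrix. *)
Definition complex_eigenvalue (R : realType) (n : nat) (A : 'M[R]_n)
    (z : R[i]%C) : bool :=
  eigenvalue (map_mx (real_complex R) A) z.

(* Main.v *)
Require Import Defs.
From mathcomp Require Import all_boot all_order all_algebra.
From mathcomp Require Import all_classical all_reals all_analysis.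
From mathcomp Require Import measurable_realfun.
From mathcomp Require Import complex ring lra.
Import Order.TTheory GRing.Theory Num.Theory.
Import numFieldNormedType.Exports.
Local Open Scope ring_scope.

(** Let z_1, ..., z_m list the complex roots of the characteristic polynomial
of A with multiplicity.  By Cayley-Hamilton the product of the A - z_k
vanishes, so if h' = A h + G then the vectors
  v_0 = h,  v_k = (A - z_k) ... (A - z_1) h
end with v_m = 0 and satisfy
  v_(k-1)' = z_k v_(k-1) + v_k + (A - z_(k-1)) ... (A - z_1) G.
Without triangularising A, the system becomes a chain of equations
v' = z v + f with a scalar coefficient z such that Re z is nonzero, solved
from the end of the chain.  Each of the three tools below is an induction on
the list of eigenvalues whose step treats one such equation.

- Local smallness ([chain_locally_small]): a solution h bounded by C whose
  forcing G is small on a long window around t is small at t.  For one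
  equation, the squared norm u of v satisfies u' <= - c u + d or
  u' >= c u - d with c = |Re z|, and Gronwall is applied over the past half
  or over the future half of the window.
- Existence of a bounded solution ([chain_bounded_solution]): a scalar
  equation with bounded continuous forcing is solved by an integral from
  minus infinity, after a rotation has removed Im z.  The solution w of the
  scalar equation solves the system because (A - z) w - w_1, where w_1 is the
  solution found one step further along the chain, is a bounded solution of
  e' = z e, hence zero.
- Stability ([chain_stable]): when every Re z_k < 0, forward Gronwall bounds h
  on [t0, +oo[ by a multiple of its initial value.

A bounded solution of h' = A h is zero by local smallness with G = 0, which
gives uniqueness.  The bounded solution x inherits unpredictability from g
([unpredictable_of_bounded]).  The difference h_k(t) = x(t + t_k) - x(t)
solves h_k' = A h_k + G_k with G_k(t) = g(t + t_k) - g(t).  As G_k tends to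
zero uniformly on compact sets, so does h_k, by local smallness.  Conversely,
G_k is bounded away from zero near u_k; by uniform continuity of g one of its
coordinates stays away from zero on an interval of fixed length, and the mean
value theorem forbids h_k to be small on that whole interval
([forcing_felt]).  As x is Lipschitz, h_k stays away from zero on an interval
of fixed length around some s_k close to u_k.  Uniform asymptotic stability
follows from [chain_stable] and from local smallness applied to the
difference of two solutions. *)

Set Implicit Arguments.
Unset Strict Implicit.
Unset Printing Implicit Defensive.
Local Open Scope classical_set_scope.

(** * Derivatives and Gronwall inequalities on the real line *)

Section pointwise_rules.
Context {R : realType}.
Implicit Types (f g : R -> R) (t a b : R).

Lemma der_eq f t a b : is_derive t 1 f a -> a = b -> is_derive t 1 f b.
Proof. by move=> fa <-. Qed.

(** Differentiation rules for functions written as abstractions: the general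
rules are stated for sums and products of functions, a form that unification
does not recover from an abstraction. *)
Lemma derD f g t a b : is_derive t 1 f a -> is_derive t 1 g b ->
  is_derive t 1 (fun s => f s + g s) (a + b).
Proof. exact: is_deriveD. Qed.

Lemma derN f t a : is_derive t 1 f a -> is_derive t 1 (fun s => - f s) (- a).
Proof. exact: is_deriveN. Qed.

Lemma derB f g t a b : is_derive t 1 f a -> is_derive t 1 g b ->
  is_derive t 1 (fun s => f s - g s) (a - b).
Proof. exact: is_deriveB. Qed.

Lemma derM f g t a b : is_derive t 1 f a -> is_derive t 1 g b ->
  is_derive t 1 (fun s => f s * g s) (a * g t + f t * b).
Proof.
move=> fa gb; have fg := is_deriveM fa gb; apply: is_derive_eq.
by rewrite addrC; congr (_ + _); rewrite /GRing.scale/= mulrC.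
Qed.

Lemma derZ f t k a : is_derive t 1 f a -> is_derive t 1 (fun s => k * f s) (k * a).
Proof. exact: is_deriveZ. Qed.

Lemma der_sum n (f : 'I_n -> R -> R) t (a : 'I_n -> R) :
  (forall i, is_derive t 1 (f i) (a i)) ->
  is_derive t 1 (fun s => \sum_i f i s) (\sum_i a i).
Proof.
move=> H; rewrite (_ : (fun s => _) = \sum_i f i); first exact: is_derive_sum.
by apply/funext => s; rewrite fct_sumE.
Qed.

Lemma der_comp_scale f t a k : is_derive (k * t) 1 f a ->
  is_derive t 1 (fun s => f (k * s)) (a * k).
Proof.
move=> fa; apply: (@is_derive1_comp _ f (fun s => k * s)) => //.
by have := derZ k (is_derive_id t 1); rewrite mulr1.
Qed.

Lemma der_expRM t a : is_derive t 1 (fun s => expR (a * s)) (a * expR (a * t)).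
Proof. by rewrite [X in is_derive _ _ _ X]mulrC; exact: der_comp_scale. Qed.

Lemma der_cont f t a : is_derive t 1 f a -> {for t, continuous f}.
Proof. by move=> [fa _]; exact/differentiable_continuous/derivable1_diffP. Qed.

End pointwise_rules.

Section gronwall_inequalities.
Context {R : realType}.
Implicit Types (u du : R -> R) (a b c d : R).

(** The function exp(c s) (u(s) - d / c) is nonincreasing.  Only right
continuity is asked at a, so that the bound applies to solutions that start
there. *)
Lemma gronwall_forward u du c d a b : 0 < c -> 0 <= d -> a <= b ->
  u @ a^'+ --> u a ->
  (forall s, a < s <= b -> is_derive s 1 u (du s)) ->
  (forall s, a < s <= b -> du s <= - c * u s + d) ->
  u b <= expR (- (c * (b - a))) * u a + d / c.
Proof.
move=> c0 d0; rewrite le_eqVlt => /predU1P[<-|ab] ua ud dule.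
  by rewrite subrr mulr0 oppr0 expR0 mul1r lerDl divr_ge0// ltW.
pose w s := expR (c * s) * (u s - d / c).
pose dw s := c * expR (c * s) * (u s - d / c) + expR (c * s) * (du s - 0).
have wd s : a < s <= b -> is_derive s 1 w (dw s).
  move=> sab; apply: derM; first exact: der_expRM.
  by apply: derB; first exact: ud.
have wc : {within `[a, b], continuous w}.
  apply/continuous_within_itvP => //; split.
  - move=> s; rewrite in_itv/= => /andP[sa sb]; apply: der_cont; apply: wd.
    by rewrite sa ltW.
  - apply: cvgM.
      apply: cvg_at_right_filter.
      exact: der_cont (der_expRM a c).
    by apply: cvgB; [exact: ua|exact: cvg_cst].
  - by apply/cvg_at_left_filter/der_cont/wd; rewrite ab lexx.
have [|s] := @MVT R w dw a b ab _ wc.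
  by move=> s; rewrite in_itv/= => /andP[sa sb]; apply: wd; rewrite sa ltW.
rewrite in_itv/= => /andP[sa sb] wba.
have dws : dw s <= 0.
  rewrite (_ : dw s = expR (c * s) * (c * (u s - d / c) + du s)).
    rewrite mulr_ge0_le0 ?expR_ge0//.
    have := dule s; rewrite sa ltW// => /(_ isT).
    rewrite mulrBr mulrCA divff ?gt_eqF// mulr1; lra.
  by rewrite /dw; ring.
have : w b - w a <= 0 by rewrite wba mulr_le0_ge0// subr_ge0 ltW.
rewrite subr_le0 /w => wle.
rewrite -lerBlDr -(ler_pM2l (expR_gt0 (c * b))) (le_trans wle)// mulrA -expRD.
rewrite (_ : c * b + _ = c * a) ?ler_pM2l ?expR_gt0//; last by ring.
by rewrite gerBl divr_ge0// ltW.
Qed.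

(** Reversal of time in [gronwall_forward]. *)
Lemma gronwall_backward u du c d a b : 0 < c -> 0 <= d -> a <= b ->
  (forall s, a <= s <= b -> is_derive s 1 u (du s)) ->
  (forall s, a <= s <= b -> c * u s - d <= du s) ->
  u a <= expR (- (c * (b - a))) * u b + d / c.
Proof.
move=> c0 d0 ab ud dule.
pose v s := u (-1 * s).
pose dv s := du (-1 * s) * -1.
have vd s : - b <= s <= - a -> is_derive s 1 v (dv s).
  by move=> /andP[h1 h2]; apply/der_comp_scale/ud; lra.
have := @gronwall_forward v dv c d (- b) (- a) c0 d0; rewrite /v.
have -> : - a - - b = b - a by ring.
have -> : -1 * - b = b by ring.
have -> : -1 * - a = a by ring.
apply.
- by lra.
- rewrite (_ : u b = v (- b)); last by rewrite /v; congr u; ring.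
  by apply/cvg_at_right_filter/der_cont/vd; lra.
- by move=> s /andP[h1 h2]; apply: vd; lra.
- move=> s /andP[h1 h2]; have := dule (-1 * s); rewrite /dv.
  move=> /(_ ltac:(lra)); lra.
Qed.

End gronwall_inequalities.

(** * Bounded solutions of scalar equations *)

Section scalar_equations.
Context {R : realType}.
Local Notation mu := (@lebesgue_measure R).
Implicit Types (f : R -> R) (a b c t M : R).

Lemma cont_expR a : continuous (fun s : R => expR (a * s)).
Proof.
move=> s; exact: der_cont (der_expRM s a).
Qed.

Lemma integral_expR b t : 0 < b ->
  (\int[mu]_(s in `]-oo, t]) (expR (b * s))%:E = (expR (b * t) / b)%:E)%E.
Proof.
move=> b0; have [r ->] : exists r, t = - r by exists (- t); rewrite opprK.
rewrite (@ge0_integration_by_substitutionNy R (fun s => expR (b * s)))//;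
  last exact/continuous_subspaceT/cont_expR.
have Fd s : is_derive s (1 : R) (fun s => - b^-1 * expR (- b * s)) (expR (b * - s)).
  apply: der_eq (derZ _ (der_expRM _ _)) _.
  by rewrite mulrA mulrNN mulVf ?gt_eqF// mul1r mulrN mulNr.
rewrite (@ge0_continuous_FTC2y _ _ (fun s => - b^-1 * expR (- b * s)) _ 0).
- rewrite sub0e -EFinN; congr EFin.
  by rewrite mulNr opprK mulrN mulNr mulrC.
- by move=> ? _; rewrite expR_ge0.
- apply: continuous_subspaceT.
  by move=> s; apply: continuous_comp; [exact: opp_continuous|exact: cont_expR].
- rewrite -(mulr0 (- b^-1)); apply: cvgM; first exact: cvg_cst.
  rewrite (_ : (fun x => expR _) =
               (fun z => expR (- z)) \o (fun z => b * z)); last first.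
    by apply: eq_fun => x; rewrite mulNr.
  apply: (@cvg_comp _ _ _ _ _ _ (pinfty_nbhs R)); last exact: cvgr_expR.
  exact: gt0_cvgMry.
- by move=> x _; have [] := Fd x.
- apply: cvg_at_right_filter; exact: der_cont (Fd r).
- by move=> x _; rewrite derive1E; have [_ ->] := Fd x.
Qed.

(** The solution is exp(a t) times the integral of exp(- a s) f(s) for s from
minus infinity to t, which converges since a < 0; the bound is that of the
integral of M exp(- a s). *)
Lemma scalar_bounded_solution_neg f a M : a < 0 -> continuous f ->
  (forall s, `|f s| <= M) ->
  exists y : R -> R, (forall t, is_derive t 1 y (a * y t + f t)) /\
    (forall t, `|y t| <= M / `|a|).
Proof.
move=> a0 cf fM; pose b := - a; have b0 : 0 < b by rewrite oppr_gt0.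
pose h (s : R) : R := expR (b * s) * f s.
have ch : continuous h.
  by move=> s; apply: cvgM; [exact: cont_expR|exact: cf].
have mexp : measurable_fun setT (fun s => expR (b * s)).
  by apply: continuous_measurable_fun; exact: cont_expR.
have iexp t : mu.-integrable `]-oo, t] (EFin \o (fun s => expR (b * s))).
  apply/integrableP; split.
    exact/measurable_EFinP/measurable_funTS.
  under eq_integral do rewrite /= ger0_norm ?expR_ge0//.
  by rewrite /= integral_expR// ltry.
have iexpM t : mu.-integrable `]-oo, t] (EFin \o (fun s => expR (b * s) * M)).
  exact: integrableZr (iexp t).
have ih t : mu.-integrable `]-oo, t] (EFin \o h).
  apply: le_integrable (iexpM t) => //.
    by apply/measurable_EFinP/measurable_funTS; exact: continuous_measurable_fun.
  move=> s _ /=; rewrite lee_fin /h !normrM ler_wpM2l//.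
  by rewrite (le_trans (fM s))// ler_norm.
pose F t := (\int[mu]_(s in `]-oo, t]) h s)%R.
have dF t : is_derive t 1 F (h t).
  have [] := @continuous_FTC1 R h -oo%O t (t + 1) _ (ih _) _ (ch t).
  - by rewrite ltrDl.
  - by rewrite ltNyr.
  by move=> d1 d2; split => //; rewrite -derive1E.
have bF t : `|F t| <= expR (b * t) / b * M.
  apply: le_trans (le_normr_Rintegral _ (ih t)) _ => //.
  have -> : expR (b * t) / b * M = \int[mu]_(s in `]-oo, t]) (expR (b * s) * M).
    by rewrite RintegralZr// /Rintegral integral_expR.
  apply: le_Rintegral => //.
  - exact: integrable_norm (ih t).
  - by move=> s _; rewrite /h normrM ger0_norm ?expR_ge0// ler_wpM2l ?expR_ge0.
exists (fun t => expR (a * t) * F t); split => t.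
  apply: der_eq (derM (der_expRM _ _) (dF _)) _.
  rewrite /h mulrA -expRD (_ : a * t + b * t = 0) ?expR0; last by rewrite /b; ring.
  by ring.
rewrite normrM gtr0_norm ?expR_gt0// (le_trans (ler_wpM2l _ (bF t))) ?expR_ge0//.
rewrite !mulrA -expRD (_ : a * t + b * t = 0) ?expR0; last by rewrite /b; ring.
by rewrite mul1r mulrC ltr0_norm.
Qed.

(** For a > 0, reverse time. *)
Lemma scalar_bounded_solution f a M : a != 0 -> continuous f ->
  (forall s, `|f s| <= M) ->
  exists y : R -> R, (forall t, is_derive t 1 y (a * y t + f t)) /\
    (forall t, `|y t| <= M / `|a|).
Proof.
move=> an0 cf fM; have [a0|a0] := ltP a 0; first exact: scalar_bounded_solution_neg.
have [||s|y [dy yM]] := @scalar_bounded_solution_neg (fun s => - f (-1 * s)) (- a) M.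
- by rewrite oppr_lt0 lt_neqAle eq_sym an0.
- move=> s; apply: cvgN; apply: continuous_comp; last exact: cf.
  by apply: cvgM; [exact: cvg_cst|exact: cvg_id].
- by rewrite normrN.
exists (fun t => y (-1 * t)); split => t; last by rewrite -(normrN a).
apply: der_eq (der_comp_scale (dy _)) _.
by rewrite mulrA mulrNN mulr1 mul1r; ring.
Qed.

Lemma der_cosM t c : is_derive t 1 (fun s => cos (c * s)) (- c * sin (c * t)).
Proof.
by apply: der_eq (der_comp_scale (is_derive_cos _)) _; ring.
Qed.

Lemma der_sinM t c : is_derive t 1 (fun s => sin (c * s)) (c * cos (c * t)).
Proof. by apply: der_eq (der_comp_scale (is_derive_sin _)) _; rewrite mulrC. Qed.

(** Real and imaginary parts of y' = (a + i c) y + f: the rotation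
exp(- i c t) y satisfies two independent real equations with coefficient a. *)
Lemma planar_bounded_solution f1 f2 a c M : a != 0 ->
  continuous f1 -> continuous f2 ->
  (forall s, `|f1 s| <= M) -> (forall s, `|f2 s| <= M) ->
  exists y1 y2 : R -> R,
    [/\ forall t, is_derive t 1 y1 (a * y1 t - c * y2 t + f1 t),
        forall t, is_derive t 1 y2 (c * y1 t + a * y2 t + f2 t),
        forall t, `|y1 t| <= 4 * M / `|a| &
        forall t, `|y2 t| <= 4 * M / `|a|].
Proof.
move=> a0 cf1 cf2 f1M f2M.
have ccos : continuous (fun s => cos (c * s)) by move=> s; exact: der_cont (der_cosM s c).
have csin : continuous (fun s => sin (c * s)) by move=> s; exact: der_cont (der_sinM s c).
have cos1 x : `|cos x| <= 1 :> R by rewrite ler_norml cos_geN1 cos_le1.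
have sin1 x : `|sin x| <= 1 :> R by rewrite ler_norml sin_geN1 sin_le1.
have comb (u v x y N : R) : `|u| <= 1 -> `|v| <= 1 -> `|x| <= N -> `|y| <= N ->
    `|u * x + v * y| <= 2 * N.
  move=> u1 v1 xN yN; rewrite (le_trans (ler_normD _ _))// mulrDl mul1r.
  by rewrite lerD// normrM -[leRHS]mul1r ler_pM.
have [||p [dp pM]] := @scalar_bounded_solution
    (fun s => cos (c * s) * f1 s + sin (c * s) * f2 s) a (2 * M) a0.
- move=> s; apply: cvgD; apply: cvgM;
    by [exact: ccos|exact: csin|exact: cf1|exact: cf2].
- by move=> s; apply: comb.
have [||q [dq qM]] := @scalar_bounded_solution
    (fun s => - sin (c * s) * f1 s + cos (c * s) * f2 s) a (2 * M) a0.
- move=> s; apply: cvgD; apply: cvgM; last first.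
  + exact: cf2.
  + exact: ccos.
  + exact: cf1.
  + by apply: cvgN; exact: csin.
- by move=> s; apply: comb; rewrite ?normrN.
have E : 4 * M / `|a| = 2 * (2 * M / `|a|) by field; rewrite normr_eq0.
exists (fun t => cos (c * t) * p t + - sin (c * t) * q t),
       (fun t => sin (c * t) * p t + cos (c * t) * q t); split => t.
- apply: der_eq (derD (derM (der_cosM _ _) (dp t)) (derM (derN (der_sinM _ _)) (dq t))) _.
  rewrite -[f1 t in RHS]mul1r -(cos2Dsin2 (c * t)); ring.
- apply: der_eq (derD (derM (der_sinM _ _) (dp t)) (derM (der_cosM _ _) (dq t))) _.
  rewrite -[f2 t in RHS]mul1r -(cos2Dsin2 (c * t)); ring.
- by rewrite E; apply: comb; rewrite ?normrN.
- by rewrite E; apply: comb.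
Qed.

End scalar_equations.

(** * Curves in complex vector spaces *)

Section complex_curves.
Context {R : realType}.
Local Notation C := (R[i]%C).
Local Notation Re := (@complex.Re R).
Local Notation Im := (@complex.Im R).

Lemma ReD (x y : C) : Re (x + y) = Re x + Re y. Proof. by case: x y => [? ?] []. Qed.
Lemma ImD (x y : C) : Im (x + y) = Im x + Im y. Proof. by case: x y => [? ?] []. Qed.
Lemma ReB (x y : C) : Re (x - y) = Re x - Re y. Proof. by case: x y => [? ?] []. Qed.
Lemma ImB (x y : C) : Im (x - y) = Im x - Im y. Proof. by case: x y => [? ?] []. Qed.
Lemma ReM (x y : C) : Re (x * y) = Re x * Re y - Im x * Im y.
Proof. by case: x y => [? ?] []. Qed.
Lemma ImM (x y : C) : Im (x * y) = Re x * Im y + Im x * Re y.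
Proof. by case: x y => [? ?] []. Qed.
Lemma Re_sum n (f : 'I_n -> C) : Re (\sum_i f i) = \sum_i Re (f i).
Proof. exact: (big_morph Re ReD). Qed.
Lemma Im_sum n (f : 'I_n -> C) : Im (\sum_i f i) = \sum_i Im (f i).
Proof. exact: (big_morph Im ImD). Qed.

(** Real and imaginary parts are differentiated separately, so that no topology
on the complex numbers is involved. *)
Definition cder n (v : R -> 'cV[C]_n) (t : R) (l : 'cV[C]_n) : Prop :=
  forall i, is_derive t (1 : R) (fun s => Re (v s i 0)) (Re (l i 0)) /\
            is_derive t (1 : R) (fun s => Im (v s i 0)) (Im (l i 0)).

Lemma cder_mulmx m n (M : 'M[C]_(m, n)) v t l :
  cder v t l -> cder (fun s => M *m v s) t (M *m l).
Proof.
move=> vl i; split.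
  rewrite (_ : (fun s => _) =
    (fun s => \sum_j (Re (M i j) * Re (v s j 0) - Im (M i j) * Im (v s j 0)))).
    apply: der_eq (der_sum (fun j => derB (derZ _ (vl j).1) (derZ _ (vl j).2))) _.
    by rewrite mxE Re_sum; apply: eq_bigr => j _; rewrite ReM.
  by apply/funext => s; rewrite mxE Re_sum; apply: eq_bigr => j _; rewrite ReM.
rewrite (_ : (fun s => _) =
  (fun s => \sum_j (Re (M i j) * Im (v s j 0) + Im (M i j) * Re (v s j 0)))).
  apply: der_eq (der_sum (fun j => derD (derZ _ (vl j).2) (derZ _ (vl j).1))) _.
  by rewrite mxE Im_sum; apply: eq_bigr => j _; rewrite ImM.
by apply/funext => s; rewrite mxE Im_sum; apply: eq_bigr => j _; rewrite ImM.
Qed.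

Lemma cderB n (v w : R -> 'cV[C]_n) t k l :
  cder v t k -> cder w t l -> cder (fun s => v s - w s) t (k - l).
Proof.
move=> vk wl i; split.
  rewrite (_ : (fun s => _) = (fun s => Re (v s i 0) - Re (w s i 0))).
    by rewrite !mxE ReB; apply: derB; [exact: (vk i).1|exact: (wl i).1].
  by apply/funext => s; rewrite !mxE ReB.
rewrite (_ : (fun s => _) = (fun s => Im (v s i 0) - Im (w s i 0))).
  by rewrite !mxE ImB; apply: derB; [exact: (vk i).2|exact: (wl i).2].
by apply/funext => s; rewrite !mxE ImB.
Qed.

Definition cdot n (v w : 'cV[C]_n) : R :=
  \sum_i (Re (v i 0) * Re (w i 0) + Im (v i 0) * Im (w i 0)).

(** Unlike the norm, its square is differentiable everywhere. *)
Definition csq n (v : 'cV[C]_n) : R := cdot v v.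

Lemma csq_ge0 n (v : 'cV[C]_n) : 0 <= csq v.
Proof. by apply: sumr_ge0 => i _; rewrite addr_ge0// -expr2 sqr_ge0. Qed.

Lemma csq_eq0 n (v : 'cV[C]_n) : csq v <= 0 -> v = 0.
Proof.
move=> v0; have /eqP : csq v == 0 by rewrite eq_le v0 csq_ge0.
rewrite /csq /cdot => /psumr_eq0P H; apply/matrixP => i j; rewrite (ord1 j) mxE.
have /eqP : Re (v i 0) * Re (v i 0) + Im (v i 0) * Im (v i 0) = 0.
  by apply: H => // k _; rewrite addr_ge0// -expr2 sqr_ge0.
rewrite -!expr2 paddr_eq0 ?sqr_ge0// !sqrf_eq0.
by case: (v i 0) => a b /= /andP[/eqP-> /eqP->].
Qed.

(** Young's inequality, with the weight c for which half of the damping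
2 Re z absorbs the cross term in the derivative of [csq]. *)
Lemma le_cdot n (v w : 'cV[C]_n) (c : R) : 0 < c ->
  `|2 * cdot v w| <= c * csq v + csq w / c.
Proof.
move=> c0.
have H (x y : R) : `|2 * (x * y)| <= c * (x * x) + (y * y) / c.
  have -> : c * (x * x) + (y * y) / c = ((c * x) ^+ 2 + y ^+ 2) / c.
    by field; rewrite gt_eqF.
  rewrite ler_pdivlMr// -[X in _ * X <= _](gtr0_norm c0) -normrM ler_norml.
  have := sqr_ge0 (c * x - y); have := sqr_ge0 (c * x + y).
  by rewrite sqrrD sqrrB => h1 h2; apply/andP; split; nra.
rewrite /csq /cdot mulr_sumr mulr_sumr mulr_suml -big_split/=.
rewrite (le_trans (ler_norm_sum _ _ _))//; apply: ler_sum => i _.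
rewrite mulrDr (le_trans (ler_normD _ _))// (le_trans (lerD (H _ _) (H _ _)))//.
by rewrite mulrDr mulrDl addrACA.
Qed.

Lemma csqD n (v w : 'cV[C]_n) : csq (v + w) <= 2 * csq v + 2 * csq w.
Proof.
rewrite /csq /cdot mulr_sumr mulr_sumr -big_split; apply: ler_sum => i _ /=.
rewrite !mxE !ReD !ImD.
have := sqr_ge0 (Re (v i 0) - Re (w i 0)); have := sqr_ge0 (Im (v i 0) - Im (w i 0)).
by rewrite !sqrrB; nra.
Qed.

(** The imaginary part of z drops out: a rotation does not change the norm. *)
Lemma cdot_scale_add n (v f : 'cV[C]_n) z :
  cdot v (z *: v + f) = Re z * csq v + cdot v f.
Proof.
rewrite /csq /cdot mulr_sumr -big_split/=; apply: eq_bigr => i _.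
by rewrite !mxE !ReD !ImD !ReM !ImM; ring.
Qed.

Lemma der_csq n (v : R -> 'cV[C]_n) t l : cder v t l ->
  is_derive t (1 : R) (fun s => csq (v s)) (2 * cdot (v t) l).
Proof.
move=> vl.
apply: der_eq (der_sum (fun i => derD (derM (vl i).1 (vl i).1) (derM (vl i).2 (vl i).2))) _.
by rewrite /cdot mulr_sumr; apply: eq_bigr => i _; ring.
Qed.

Lemma le_csq n (v : 'cV[C]_n) i :
  `|Re (v i 0)| <= Num.sqrt (csq v) /\ `|Im (v i 0)| <= Num.sqrt (csq v).
Proof.
have h : Re (v i 0) ^+ 2 + Im (v i 0) ^+ 2 <= csq v.
  rewrite /csq /cdot (bigD1 i)//= !expr2 lerDl sumr_ge0// => j _.
  by rewrite addr_ge0// -expr2 sqr_ge0.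
by split; rewrite -sqrtr_sqr ler_wsqrtr// (le_trans _ h)// ?lerDl ?lerDr sqr_ge0.
Qed.

Lemma csq_le n (v : 'cV[C]_n) r :
  (forall i, `|Re (v i 0)| <= r) -> (forall i, `|Im (v i 0)| <= r) ->
  csq v <= n%:R * (2 * r ^+ 2).
Proof.
move=> h1 h2; rewrite mulr_natl -[X in _ *+ X]card_ord -sumr_const.
apply: ler_sum => i _; rewrite mulrDl mul1r -!expr2.
by rewrite lerD// -[leLHS]real_normK ?num_real// ler_sqr ?nnegrE// (le_trans _ (h1 i)).
Qed.

(** A crude operator bound; only its independence of v matters. *)
Lemma csq_mulmx m n (M : 'M[C]_(m, n)) :
  exists2 K : R, 0 <= K & forall v : 'cV_n, csq (M *m v) <= K * csq v.
Proof.
pose k := \sum_i \sum_j (`|Re (M i j)| + `|Im (M i j)|).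
have k0 : 0 <= k by do 2 (apply: sumr_ge0 => ? _); rewrite addr_ge0.
exists (m%:R * (2 * k ^+ 2)); first by rewrite !mulr_ge0// sqr_ge0.
move=> v.
have -> : m%:R * (2 * k ^+ 2) * csq v = m%:R * (2 * (k * Num.sqrt (csq v)) ^+ 2).
  by rewrite exprMn sqr_sqrtr ?csq_ge0// !mulrA.
have H (f : C -> R) i : (forall j, `|f (M i j * v j 0)| <=
    (`|Re (M i j)| + `|Im (M i j)|) * Num.sqrt (csq v)) ->
  `|\sum_j f (M i j * v j 0)| <= k * Num.sqrt (csq v).
  move=> fM; rewrite (le_trans (ler_norm_sum _ _ _))//.
  rewrite (le_trans (ler_sum _ (fun j _ => fM j)))// -mulr_suml ler_wpM2r ?sqrtr_ge0//.
  by rewrite /k (bigD1 i)//= lerDl; do 2 (apply: sumr_ge0 => ? _); rewrite addr_ge0.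
have B (a b x y : R) i : (x = Re (v i 0) /\ y = Im (v i 0)) \/
   (y = Re (v i 0) /\ x = Im (v i 0)) ->
   `|a * x| + `|b * y| <= (`|a| + `|b|) * Num.sqrt (csq v).
  have [h1 h2] := le_csq v i.
  by case=> -[-> ->]; rewrite mulrDl !normrM lerD// ler_wpM2l.
apply: csq_le => i; rewrite mxE ?Re_sum ?Im_sum; apply: H => j.
  by rewrite ReM (le_trans (ler_normB _ _))// (B _ _ _ _ j)//; left.
by rewrite ImM (le_trans (ler_normD _ _))// (B _ _ _ _ j)//; right.
Qed.

End complex_curves.

(** * Smallness along the chain of eigenvalues *)

Section chain_smallness.
Context {R : realType}.
Local Notation C := (R[i]%C).
Local Notation Re := (@complex.Re R).

(** Replaces a logarithm when a time is chosen after which an exponential is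
small. *)
Lemma expRN_le (x : R) : 0 <= x -> expR (- x) <= (1 + x)^-1.
Proof.
move=> x0; rewrite expRN lef_pV2 ?posrE ?expR_gt0 ?ltr_pwDl//.
exact: expR_ge1Dx.
Qed.

(** If Re z < 0 the value at t is controlled by the past of t, if Re z > 0 by
its future.  A symmetric window serves both signs, so that the statement can
be iterated over eigenvalues of either sign. *)
Lemma mode_locally_small n (z : C) (Cb e : R) : Re z != 0 -> 0 < e ->
  exists L eta : R, [/\ 0 < L, 0 < eta &
    forall (v f : R -> 'cV[C]_n) t,
      (forall s, `|s - t| < L -> [/\ cder v s (z *: v s + f s),
                                    csq (v s) <= Cb & csq (f s) <= eta]) ->
      csq (v t) <= e].
Proof.
move=> z0 e0; pose c := `|Re z|; have c0 : 0 < c by rewrite normr_gt0.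
have [B0 CbB] : 0 <= `|Cb| /\ Cb <= `|Cb| by split => //; exact: ler_norm.
(* T makes the contribution of the end of the window at most e / 2, since
   exp(- c T) <= 1 / (1 + c T); eta makes that of the forcing equal to e / 2.
   The extra 1 in the window makes room for the closed interval of radius T. *)
pose T := 2 * `|Cb| / (e * c); pose eta := e / 2 * c * c.
have T0 : 0 <= T by rewrite /T divr_ge0 ?mulr_ge0// ltW.
have eta0 : 0 < eta by rewrite /eta !mulr_gt0// divr_gt0.
exists (T + 1), eta; split => //; first by rewrite ltr_wpDl.
move=> v f t H.
have key : expR (- (c * T)) * Cb + eta / c / c <= e.
  have -> : eta / c / c = e / 2 by rewrite /eta; field; rewrite gt_eqF.
  rewrite -lerBrDr (_ : e - e / 2 = e / 2); last by field.
  rewrite (le_trans (ler_wpM2l (expR_ge0 _) CbB))//.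
  rewrite (le_trans (ler_wpM2r B0 (expRN_le _)))//; first by rewrite mulr_ge0// ltW.
  have p : 0 < 1 + c * T by rewrite ltr_pwDl// mulr_ge0// ltW.
  rewrite mulrC ler_pdivrMr//.
  have -> : e / 2 * (1 + c * T) = e / 2 + `|Cb|.
    by rewrite /T; field; rewrite !gt_eqF.
  by rewrite lerDr divr_ge0// ltW.
have near s : t - T <= s <= t + T -> `|s - t| < T + 1.
  by move=> /andP[h1 h2]; rewrite ltr_norml; apply/andP; split; lra.
have bd s : t - T <= s <= t + T ->
    `|2 * cdot (v s) (f s)| <= c * csq (v s) + eta / c.
  move=> /near/H[_ _ fs]; rewrite (le_trans (le_cdot _ _ c0))// lerD2l.
  by rewrite ler_pM2r// invr_gt0.
pose du s := 2 * cdot (v s) (z *: v s + f s).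
have dud s : t - T <= s <= t + T -> is_derive s (1 : R) (fun s => csq (v s)) (du s).
  by move=> /near/H[vs _ _]; exact: der_csq.
have etac : 0 <= eta / c by rewrite divr_ge0// ltW.
have [zneg|zpos] := ltP (Re z) 0.
  have zc : Re z = - c by rewrite /c ltr0_norm// opprK.
  have tT : t - T <= t by rewrite gerBl.
  have sub s : t - T < s <= t -> t - T <= s <= t + T.
    by move=> /andP[h1 h2]; apply/andP; split; lra.
  have := @gronwall_forward R (fun s => csq (v s)) du c (eta / c) (t - T) t c0 etac tT.
  have tTT : t - T <= t - T <= t + T by apply/andP; split; lra.
  move=> /(_ (cvg_at_right_filter (der_cont (dud _ tTT)))).
  move=> /(_ (fun s st => dud s (sub s st))).
  have h s : t - T < s <= t -> du s <= - c * csq (v s) + eta / c.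
    move=> /sub/bd; rewrite /du cdot_scale_add zc ler_norml => /andP[_]; lra.
  move=> /(_ h) /le_trans; apply; rewrite (_ : t - (t - T) = T); last by ring.
  apply: le_trans key; rewrite lerD2r ler_wpM2l ?expR_ge0//.
  by have [] := H _ (near _ tTT).
have zc : Re z = c by rewrite /c ger0_norm.
have tT : t <= t + T by rewrite lerDl.
have sub s : t <= s <= t + T -> t - T <= s <= t + T.
  by move=> /andP[h1 h2]; apply/andP; split; lra.
have := @gronwall_backward R (fun s => csq (v s)) du c (eta / c) t (t + T) c0 etac tT.
move=> /(_ (fun s st => dud s (sub s st))).
have h s : t <= s <= t + T -> c * csq (v s) - eta / c <= du s.
  move=> /sub/bd; rewrite /du cdot_scale_add zc ler_norml => /andP[+ _]; lra.
move=> /(_ h) /le_trans; apply; rewrite (_ : t + T - t = T); last by ring.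
apply: le_trans key; rewrite lerD2r ler_wpM2l ?expR_ge0//.
have tTT : t - T <= t + T <= t + T by apply/andP; split; lra.
by have [] := H _ (near _ tTT).
Qed.

Lemma mode_bounded_eq0 n (z : C) (Cb : R) (v : R -> 'cV[C]_n) : Re z != 0 ->
  (forall t, cder v t (z *: v t)) -> (forall t, csq (v t) <= Cb) ->
  forall t, v t = 0.
Proof.
move=> z0 dv vC t; apply: csq_eq0; apply/ler_addgt0Pr => e e0; rewrite add0r.
have [L [eta [_ eta0 H]]] := @mode_locally_small n z Cb e z0 e0.
apply: (H v (fun=> 0)) => s _; split => //; first by rewrite addr0.
by rewrite /csq /cdot big1 ?ltW// => i _; rewrite !mxE/= !mulr0 addr0.
Qed.

(** The product of the A - z over l, in the order that peels off the head of l
next to the argument. *)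
Fixpoint shift_prod n (A : 'M[C]_n) (l : seq C) : 'M[C]_n :=
  if l is z :: l' then shift_prod A l' *m (A - z%:M) else 1%:M.

(** Differentiating M h, with A = z + (A - z), produces the next member
(A - z) M h of the chain. *)
Lemma chain_step n (A M : 'M[C]_n) z (h G : R -> 'cV[C]_n) t :
  A *m M = M *m A -> cder h t (A *m h t + G t) ->
  cder (fun s => M *m h s) t
    (z *: (M *m h t) + ((A - z%:M) *m M *m h t + M *m G t)).
Proof.
move=> AM hd; have := cder_mulmx M hd; congr cder.
rewrite !mulmxBl mul_scalar_mx mulmxDr mulmxA -AM !scalemxAl addrA.
by rewrite [in RHS]addrCA subrr addr0.
Qed.

Lemma shift_comm n (A M : 'M[C]_n) z : A *m M = M *m A ->
  A *m ((A - z%:M) *m M) = (A - z%:M) *m M *m A.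
Proof.
move=> AM; rewrite -mulmxA -AM !mulmxBl !mulmxBr !mul_scalar_mx.
by rewrite -!scalemxAr !mulmxA.
Qed.

(** Induction on l, with M the product of the factors already used.  The window
of the next member of the chain is added to the window of the current
equation, because smallness of the forcing is needed at all times of the
latter. *)
Lemma chain_locally_small n (A : 'M[C]_n) (l : seq C) (M : 'M[C]_n) :
  (forall z, z \in l -> Re z != 0) -> A *m M = M *m A ->
  shift_prod A l *m M = 0 ->
  forall Cb e : R, 0 < e -> exists L eta : R, [/\ 0 < L, 0 < eta &
    forall (h G : R -> 'cV[C]_n) t,
      (forall s, `|s - t| < L -> [/\ cder h s (A *m h s + G s),
                                    csq (h s) <= Cb & csq (G s) <= eta]) ->
      csq (M *m h t) <= e].
Proof.
elim: l M => [|z l IH] M lz AM /=.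
  rewrite mul1mx => -> Cb e e0; exists 1, 1; split => // h G t _.
  rewrite mul0mx /csq /cdot big1 ?ltW// => i _.
  by rewrite !mxE/= !mulr0 addr0.
rewrite -mulmxA => M0 Cb e e0.
have [K K0 MK] := csq_mulmx M.
have z0 : Re z != 0 by apply: lz; rewrite mem_head.
have [L1 [eta1 [L10 eta10 H1]]] := @mode_locally_small n z (K * Cb) e z0 e0.
have lz' z' : z' \in l -> Re z' != 0 by move=> z'l; apply: lz; rewrite in_cons z'l orbT.
have e10 : 0 < eta1 / 4 by rewrite divr_gt0.
have [L2 [eta2 [L20 eta20 H2]]] := IH _ lz' (shift_comm z AM) M0 Cb _ e10.
have K1 : 0 < K + 1 by rewrite ltr_wpDl.
exists (L1 + L2), (Num.min eta2 (eta1 / 4 / (K + 1))); split.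
- exact: addr_gt0.
- by rewrite lt_min eta20/= divr_gt0.
move=> h G t H.
apply: (H1 (fun s => M *m h s) (fun s => (A - z%:M) *m M *m h s + M *m G s) t) => s st.
have [|hs hC hG] := H s; first by rewrite (lt_trans st)// ltrDl.
split.
- exact: chain_step.
- by rewrite (le_trans (MK _))// ler_wpM2l.
rewrite (le_trans (csqD _ _))//.
have h2 : csq ((A - z%:M) *m M *m h s) <= eta1 / 4.
  apply: (H2 h G s) => r rs; have [|hr hrC] := H r.
    by rewrite -(subrKA s) (le_lt_trans (ler_normD _ _))// addrC ltrD.
  by rewrite le_min => /andP[? _].
have h3 : csq (M *m G s) <= eta1 / 4.
  rewrite (le_trans (MK _))//; move: hG; rewrite le_min => /andP[_].
  rewrite ler_pdivlMr// => /(le_trans _); apply.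
  by rewrite mulrC ler_wpM2l ?csq_ge0// lerDl.
by lra.
Qed.

End chain_smallness.

(** * Stability and bounded solutions along the chain *)

Section chain_solutions.
Context {R : realType}.
Local Notation C := (R[i]%C).
Local Notation Re := (@complex.Re R).
Local Notation Im := (@complex.Im R).

(** Convergence along a general filter serves both continuity on the line and
right continuity at an initial time. *)
Definition ccvg (F : set_system R) n (v : R -> 'cV[C]_n) (l : 'cV[C]_n) : Prop :=
  forall i, Re (v s i 0) @[s --> F] --> Re (l i 0) /\
            Im (v s i 0) @[s --> F] --> Im (l i 0).

Lemma cvg_sumr (T : Type) (F : set_system T) {FF : Filter F} m
    (f : 'I_m -> T -> R) (a : 'I_m -> R) :
  (forall i, f i x @[x --> F] --> a i) ->
  (\sum_i f i x) @[x --> F] --> \sum_i a i.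
Proof.
elim: m f a => [|m IH] f a fa.
  by rewrite big_ord0; under eq_fun do rewrite big_ord0; exact: cvg_cst.
rewrite big_ord_recl; under eq_fun do rewrite big_ord_recl.
by apply: cvgD; [exact: fa|apply: IH => i; exact: fa].
Qed.

Lemma ccvg_mulmx (F : set_system R) {FF : Filter F} m n (M : 'M[C]_(m, n)) v l :
  ccvg F v l -> ccvg F (fun s => M *m v s) (M *m l).
Proof.
move=> vl i; split.
  have -> : (fun s => Re ((M *m v s) i 0)) =
    (fun s => \sum_j (Re (M i j) * Re (v s j 0) - Im (M i j) * Im (v s j 0))).
    by apply/funext => s; rewrite mxE Re_sum; apply: eq_bigr => j _; rewrite ReM.
  rewrite mxE Re_sum; under [X in _ --> X]eq_bigr do rewrite ReM.
  by apply: cvg_sumr => j; apply: cvgB; apply: (cvgM (cvg_cst _)); have [] := vl j.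
have -> : (fun s => Im ((M *m v s) i 0)) =
  (fun s => \sum_j (Re (M i j) * Im (v s j 0) + Im (M i j) * Re (v s j 0))).
  by apply/funext => s; rewrite mxE Im_sum; apply: eq_bigr => j _; rewrite ImM.
rewrite mxE Im_sum; under [X in _ --> X]eq_bigr do rewrite ImM.
by apply: cvg_sumr => j; apply: cvgD; apply: (cvgM (cvg_cst _)); have [] := vl j.
Qed.

Lemma ccvgD (F : set_system R) {FF : Filter F} n (v w : R -> 'cV[C]_n) k l :
  ccvg F v k -> ccvg F w l -> ccvg F (fun s => v s + w s) (k + l).
Proof.
move=> vk wl i; split.
  rewrite mxE ReD; under eq_fun do rewrite mxE ReD.
  by apply: cvgD; [exact: (vk i).1|exact: (wl i).1].
rewrite mxE ImD; under eq_fun do rewrite mxE ImD.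
by apply: cvgD; [exact: (vk i).2|exact: (wl i).2].
Qed.

Lemma ccvg_csq (F : set_system R) {FF : Filter F} n (v : R -> 'cV[C]_n) l :
  ccvg F v l -> csq (v s) @[s --> F] --> csq l.
Proof.
move=> vl; apply: cvg_sumr => i.
by apply: cvgD; apply: cvgM; have [] := vl i.
Qed.

Lemma cder_cvg n (v : R -> 'cV[C]_n) t l : cder v t l -> ccvg (nbhs t) v (v t).
Proof. by move=> d i; have [d1 d2] := d i; split; [exact: der_cont d1|exact: der_cont d2]. Qed.

(** The next member of the chain is bounded by the initial value on the whole of
[t0, +oo[ by induction, and is the forcing of a damped equation. *)
Lemma chain_stable n (A : 'M[C]_n) (l : seq C) (M : 'M[C]_n) :
  (forall z, z \in l -> Re z < 0) -> A *m M = M *m A ->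
  shift_prod A l *m M = 0 ->
  exists2 K : R, 0 <= K & forall (h : R -> 'cV[C]_n) t0, ccvg t0^'+ h (h t0) ->
    (forall t, t0 < t -> cder h t (A *m h t)) ->
    forall t, t0 <= t -> csq (M *m h t) <= K * csq (h t0).
Proof.
elim: l M => [|z l IH] M lz AM /=.
  rewrite mul1mx => ->; exists 0 => // h t0 _ _ t _.
  by rewrite mul0mx /csq /cdot big1 ?mul0r// => i _; rewrite !mxE/= !mulr0 addr0.
rewrite -mulmxA => M0.
have [K1 K10 MK] := csq_mulmx M.
have lz' z' : z' \in l -> Re z' < 0 by move=> z'l; apply: lz; rewrite in_cons z'l orbT.
have [K2 K20 H2] := IH _ lz' (shift_comm z AM) M0.
have z0 : Re z < 0 by apply: lz; rewrite mem_head.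
pose c := - Re z; have c0 : 0 < c by rewrite oppr_gt0.
exists (K1 + K2 / c / c); first by rewrite addr_ge0// !divr_ge0// ltW.
move=> h t0 ht0 dh t tt0.
pose S := csq (h t0); have S0 : 0 <= S by exact: csq_ge0.
pose v s := M *m h s; pose f s := (A - z%:M) *m M *m h s.
have dv s : t0 < s -> cder v s (z *: v s + f s).
  move=> /dh hs; have := @chain_step _ _ A M z h (fun=> 0) s AM.
  by rewrite addr0 mulmx0 addr0; apply.
have fS s : t0 <= s -> csq (f s) <= K2 * S by move=> s0; exact: H2.
have := @gronwall_forward R (fun s => csq (v s)) (fun s => 2 * cdot (v s) (z *: v s + f s))
  c (K2 * S / c) t0 t c0 _ tt0.
move=> /(_ _ _ _ _)/le_trans; apply.
- by rewrite divr_ge0 ?mulr_ge0// ltW.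
- by apply: ccvg_csq; exact: ccvg_mulmx.
- by move=> s /andP[/dv vs _]; exact: der_csq.
- move=> s /andP[s0 _]; rewrite cdot_scale_add.
  have := le_cdot (v s) (f s) c0; rewrite ler_norml => /andP[_ h1].
  have h2 : csq (f s) / c <= K2 * S / c by rewrite ler_pM2r ?invr_gt0// fS// ltW.
  by rewrite /c in h1 h2 *; lra.
rewrite mulrDl lerD//; last first.
  by rewrite le_eqVlt; apply/orP; left; apply/eqP; rewrite /S; field; rewrite gt_eqF.
rewrite (le_trans _ (MK _))// ler_piMl ?csq_ge0// -expR0 ler_expR.
by rewrite oppr_le0 mulr_ge0 ?subr_ge0// ltW.
Qed.

Definition cbounded n (v : R -> 'cV[C]_n) : Prop :=
  exists B : R, forall t, csq (v t) <= B.

Definition ccontinuous n (v : R -> 'cV[C]_n) : Prop :=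
  forall t, ccvg (nbhs t) v (v t).

Lemma cboundedD n (v w : R -> 'cV[C]_n) :
  cbounded v -> cbounded w -> cbounded (fun s => v s + w s).
Proof.
move=> [B1 h1] [B2 h2]; exists (2 * B1 + 2 * B2) => t.
by rewrite (le_trans (csqD _ _))// lerD// ler_pM2l.
Qed.

Lemma cbounded_mulmx m n (M : 'M[C]_(m, n)) (v : R -> 'cV[C]_n) :
  cbounded v -> cbounded (fun s => M *m v s).
Proof.
move=> [B h]; have [K K0 MK] := csq_mulmx M; exists (K * B) => t.
by rewrite (le_trans (MK _))// ler_wpM2l.
Qed.

(** The equation splits into coordinates, each of them a planar system. *)
Lemma mode_bounded_solution n (z : C) (f : R -> 'cV[C]_n) : Re z != 0 ->
  ccontinuous f -> cbounded f ->
  exists2 w : R -> 'cV[C]_n, cbounded w & forall t, cder w t (z *: w t + f t).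
Proof.
move=> z0 cf [B fB].
pose r := Num.sqrt B.
have fr t i : `|Re (f t i 0)| <= r /\ `|Im (f t i 0)| <= r.
  by have [h1 h2] := le_csq (f t) i; split;
    [apply: le_trans h1 _|apply: le_trans h2 _]; rewrite ler_wsqrtr.
have /choice[y yP] i := @planar_bounded_solution R _ _ _ (Im z) r z0
  (fun t => (cf t i).1) (fun t => (cf t i).2)
  (fun t => (fr t i).1) (fun t => (fr t i).2).
have /choice[x xP] := yP.
exists (fun t => \col_i (Complex (y i t) (x i t))).
  exists (n%:R * (2 * (4 * r / `|Re z|) ^+ 2)) => t.
  by apply: csq_le => i; rewrite mxE/=; have [_ _ h1 h2] := xP i.
move=> t i; have [d1 d2 _ _] := xP i; rewrite !mxE; split.
  rewrite (_ : (fun s => _) = y i); last by apply/funext => s; rewrite mxE.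
  by rewrite ReD ReM.
rewrite (_ : (fun s => _) = x i); last by apply/funext => s; rewrite mxE.
by rewrite ImD ImM/= [Re z * _ + _]addrC.
Qed.

(** Solve w' = z w + w1 + M g, where w1 solves the system forced by (A - z) M g.
The defect e = (A - z) w - w1 satisfies e' = z e, because the two terms
(A - z) M g cancel, and is bounded; hence e = 0 and z w + w1 = A w. *)
Lemma chain_bounded_solution n (A : 'M[C]_n) (l : seq C) (M : 'M[C]_n)
    (g : R -> 'cV[C]_n) :
  (forall z, z \in l -> Re z != 0) -> A *m M = M *m A ->
  shift_prod A l *m M = 0 -> ccontinuous g -> cbounded g ->
  exists2 w : R -> 'cV[C]_n, cbounded w & forall t, cder w t (A *m w t + M *m g t).
Proof.
move=> + + + cg bg; elim: l M => [|z l IH] M lz AM /=.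
  rewrite mul1mx => ->; exists (fun=> 0).
    by exists 0 => t; rewrite /csq /cdot big1// => i _; rewrite !mxE/= !mulr0 addr0.
  by move=> t i; rewrite mulmx0 mul0mx addr0 !mxE/=; split; exact: is_derive_cst.
rewrite -mulmxA => M0.
have lz' z' : z' \in l -> Re z' != 0 by move=> z'l; apply: lz; rewrite in_cons z'l orbT.
have z0 : Re z != 0 by apply: lz; rewrite mem_head.
have [w1 bw1 dw1] := IH _ lz' (shift_comm z AM) M0.
have [w bw dw] := @mode_bounded_solution _ z (fun s => w1 s + M *m g s) z0
  (fun t => ccvgD (cder_cvg (dw1 t)) (ccvg_mulmx M (cg t)))
  (cboundedD bw1 (cbounded_mulmx M bg)).
exists w => // t.
have de s : cder (fun s => (A - z%:M) *m w s - w1 s) s (z *: ((A - z%:M) *m w s - w1 s)).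
  have := cderB (cder_mulmx (A - z%:M) (dw s)) (dw1 s); congr cder.
  rewrite -[(A - z%:M) *m M *m _]mulmxA !mulmxDr opprD [X in X = _]addrACA.
  rewrite [(A - z%:M) *m w1 s]mulmxBl mul_scalar_mx -scalemxAr scalerBr.
  by rewrite addrK addrA subrK.
have [B eB] : cbounded (fun s => (A - z%:M) *m w s - w1 s).
  have := cboundedD (cbounded_mulmx (A - z%:M) bw) (cbounded_mulmx (- 1%:M) bw1).
  by under eq_fun do rewrite mulNmx mul1mx.
have /subr0_eq e := mode_bounded_eq0 z0 de eB t.
have := dw t; congr cder; rewrite addrA -e mulmxBl mul_scalar_mx.
by rewrite addrCA subrr addr0.
Qed.

End chain_solutions.

(** * Systems with a real matrix *)

Section real_system.
Context {R : realType}.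
Local Notation C := (R[i]%C).
Local Notation Re := (@complex.Re R).
Local Notation Im := (@complex.Im R).

Lemma shift_prod_horner n (A : 'M[C]_n.+1) l :
  shift_prod A l = horner_mx A (\prod_(z <- l) ('X - z%:P)).
Proof.
elim: l => [|z l IH] /=; first by rewrite big_nil !rmorph1.
rewrite big_cons mulrC rmorphM/= -IH rmorphB/= horner_mx_X horner_mx_C.
by rewrite mulmxE.
Qed.

(** Cayley-Hamilton for a characteristic polynomial that splits. *)
Lemma shift_prod_eigenvalues_eq0 n (A : 'M[C]_n) : (0 < n)%N ->
  exists2 l : seq C, {in l, forall z, eigenvalue A z} & shift_prod A l = 0.
Proof.
case: n A => // n A _; have [l lE] := closed_field_poly_normal (char_poly A).
have lE' : char_poly A = \prod_(z <- l) ('X - z%:P).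
  by rewrite lE (monicP (char_poly_monic A)) scale1r.
exists l; last by rewrite shift_prod_horner -lE' Cayley_Hamilton.
by move=> z zl; rewrite eigenvalue_root_char lE' root_prod_XsubC.
Qed.

Lemma is_derive_entry n (x : R -> 'cV[R]_n) (t : R) l :
  is_derive t (1 : R) x l <->
  forall i, is_derive t (1 : R) (fun s => x s i 0) (l i 0).
Proof.
split=> [[d xl] i|H].
  split; first exact: (derivable_mxP x t 1).1 d i 0.
  by rewrite -xl derive_mx// mxE.
have d : derivable x t 1.
  by apply/derivable_mxP => i j; rewrite (ord1 j); case: (H i).
split => //; rewrite derive_mx//; apply/matrixP => i j; rewrite mxE (ord1 j).
by case: (H i).
Qed.

(** Passing to complex vectors gives access to eigenvalues that are not real;
the real part brings solutions back, the matrix being real. *)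
Definition cplx n (v : 'cV[R]_n) : 'cV[C]_n := map_mx (real_complex R) v.

Lemma Re_cplx n (v : 'cV[R]_n) i : Re (cplx v i 0) = v i 0.
Proof. by rewrite mxE. Qed.

Lemma Im_cplx n (v : 'cV[R]_n) i : Im (cplx v i 0) = 0.
Proof. by rewrite mxE. Qed.

Lemma enorm_ge0 n (v : 'cV[R]_n) : 0 <= enorm v.
Proof. exact: sqrtr_ge0. Qed.

Lemma csq_cplx n (v : 'cV[R]_n) : csq (cplx v) = enorm v ^+ 2.
Proof.
rewrite sqr_sqrtr ?sumr_ge0// => [|i _]; last exact: sqr_ge0.
by apply: eq_bigr => i _; rewrite Re_cplx Im_cplx mulr0 addr0.
Qed.

Lemma cplx_affine n (A : 'M[R]_n) v w :
  cplx (A *m v + w) = map_mx (real_complex R) A *m cplx v + cplx w.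
Proof. by rewrite /cplx map_mxD map_mxM. Qed.

Lemma cder_cplx n (x : R -> 'cV[R]_n) t l :
  is_derive t (1 : R) x l -> cder (fun s => cplx (x s)) t (cplx l).
Proof.
move=> /is_derive_entry H i; rewrite Re_cplx Im_cplx; split.
  by under eq_fun do rewrite Re_cplx.
by under eq_fun do rewrite Im_cplx; exact: is_derive_cst.
Qed.

Lemma le_enorm n (v : 'cV[R]_n) i : `|v i 0| <= enorm v.
Proof.
rewrite -sqrtr_sqr ler_wsqrtr// (bigD1 i)//= lerDl sumr_ge0// => j _.
exact: sqr_ge0.
Qed.

(** Crude constant, sufficient wherever only boundedness or smallness matters. *)
Lemma enorm_le n (v : 'cV[R]_n) r :
  (forall i, `|v i 0| <= r) -> enorm v <= n%:R * r.
Proof.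
case: n v => [v _|n v vr]; first by rewrite /enorm big_ord0 sqrtr0 mul0r.
have r0 : 0 <= r by exact: le_trans (vr ord0).
rewrite -[leRHS]ger0_norm ?mulr_ge0// -sqrtr_sqr ler_wsqrtr//.
apply: (@le_trans _ _ (\sum_(i < n.+1) r ^+ 2)).
  by apply: ler_sum => i _; rewrite -[leLHS]real_normK ?num_real// ler_sqr ?nnegrE.
rewrite sumr_const card_ord exprMn -[leLHS]mulr_natl ler_wpM2r ?sqr_ge0//.
by rewrite expr2 ler_peMr// ler1n.
Qed.

Lemma enorm_eq0 n (v : 'cV[R]_n) : enorm v <= 0 -> v = 0.
Proof.
move=> v0; apply/matrixP => i j; rewrite (ord1 j) mxE; apply/eqP.
by rewrite -normr_le0 (le_trans (le_enorm _ _)).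
Qed.

Section fixed_matrix.
Variables (n : nat) (hn : (0 < n)%N) (A : 'M[R]_n).
Let AC := map_mx (real_complex R) A.

Lemma system_locally_small :
  (forall z, complex_eigenvalue A z -> Re z != 0) ->
  forall Cb e : R, 0 < e -> exists L eta : R, [/\ 0 < L, 0 < eta &
    forall (h G : R -> 'cV[R]_n) t,
      (forall s, `|s - t| < L ->
        [/\ is_derive s (1 : R) h (A *m h s + G s), enorm (h s) <= Cb &
            enorm (G s) <= eta]) ->
      enorm (h t) <= e].
Proof.
move=> hA Cb e e0; have [l lA lp] := shift_prod_eigenvalues_eq0 AC hn.
have [||||L [eta [L0 eta0 H]]] :=
    @chain_locally_small R n AC l 1%:M _ _ _ (Cb ^+ 2) (e ^+ 2) _.
- by move=> z /lA/hA.
- by rewrite mulmx1 mul1mx.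
- by rewrite lp mul0mx.
- by rewrite exprn_gt0.
exists L, (Num.sqrt eta); split; rewrite ?sqrtr_gt0// => h G t hG.
rewrite -ler_sqr ?nnegrE ?enorm_ge0 ?(ltW e0)// -csq_cplx.
rewrite -[cplx _]mul1mx; apply: (H (fun s => cplx (h s)) (fun s => cplx (G s)) t).
move=> s /hG[hs hC Geta]; rewrite !csq_cplx; split.
- by rewrite -cplx_affine; exact: cder_cplx.
- by rewrite ler_sqr ?nnegrE ?enorm_ge0// (le_trans (enorm_ge0 _) hC).
- rewrite -[leRHS](@sqr_sqrtr _ eta) ?(ltW eta0)//.
  by rewrite ler_sqr ?nnegrE ?enorm_ge0 ?sqrtr_ge0.
Qed.

(** The forcing 0 is below every threshold of [system_locally_small]. *)
Lemma bounded_homogeneous_eq0 (Cb : R) (h : R -> 'cV[R]_n) :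
  (forall z, complex_eigenvalue A z -> Re z != 0) ->
  (forall t, is_derive t (1 : R) h (A *m h t)) ->
  (forall t, enorm (h t) <= Cb) -> forall t, h t = 0.
Proof.
move=> hA dh hC t; apply: enorm_eq0; apply/ler_addgt0Pr => e e0; rewrite add0r.
have [L [eta [_ eta0 H]]] := system_locally_small hA Cb e0.
apply: (H h (fun=> 0)) => s _; split => //; first by rewrite addr0.
by rewrite /enorm big1 ?sqrtr0 ?ltW// => i _; rewrite mxE expr0n.
Qed.

Lemma homogeneous_stable :
  (forall z, complex_eigenvalue A z -> Re z < 0) ->
  exists2 K : R, 0 <= K & forall (h : R -> 'cV[R]_n) t0,
    (forall i, h s i 0 @[s --> t0^'+] --> h t0 i 0) ->
    (forall t, t0 < t -> is_derive t (1 : R) h (A *m h t)) ->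
    forall t, t0 <= t -> enorm (h t) <= K * enorm (h t0).
Proof.
move=> hA; have [l lA lp] := shift_prod_eigenvalues_eq0 AC hn.
have [||| K K0 H] := @chain_stable R n AC l 1%:M.
- by move=> z /lA/hA.
- by rewrite mulmx1 mul1mx.
- by rewrite lp mul0mx.
exists (Num.sqrt K); first exact: sqrtr_ge0.
move=> h t0 ht0 dh t tt0.
rewrite -ler_sqr ?nnegrE ?mulr_ge0 ?sqrtr_ge0 ?enorm_ge0//.
rewrite exprMn [Num.sqrt K ^+ 2]sqr_sqrtr// -!csq_cplx -[cplx (h t)]mul1mx.
apply: (H (fun s => cplx (h s))) => // [i|s /dh hs].
  rewrite Re_cplx Im_cplx; split; first by under eq_fun do rewrite Re_cplx; exact: ht0.
  by under eq_fun do rewrite Im_cplx; exact: cvg_cst.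
have := cder_cplx hs; congr cder.
by rewrite -[A *m h s]addr0 cplx_affine /cplx map_mx0 addr0.
Qed.

Lemma system_bounded_solution (B : R) (g : R -> 'cV[R]_n) :
  (forall z, complex_eigenvalue A z -> Re z != 0) ->
  (forall i, continuous (fun s => g s i 0)) ->
  (forall t, enorm (g t) <= B) ->
  exists2 x, solution A g x & exists D : R, forall t, enorm (x t) <= D.
Proof.
move=> hA cg gB; have [l lA lp] := shift_prod_eigenvalues_eq0 AC hn.
have [||||| w [D wD] dw] := @chain_bounded_solution R n AC l 1%:M (fun s => cplx (g s)).
- by move=> z /lA/hA.
- by rewrite mulmx1 mul1mx.
- by rewrite lp mul0mx.
- move=> t i; split.
    by under eq_fun do rewrite Re_cplx; rewrite Re_cplx; exact: cg.
  by under eq_fun do rewrite Im_cplx; rewrite Im_cplx; exact: cvg_cst.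
- exists (B ^+ 2) => t; rewrite csq_cplx ler_sqr ?nnegrE ?enorm_ge0//.
  by rewrite (le_trans (enorm_ge0 _) (gB t)).
exists (fun t => map_mx Re (w t)).
  move=> t; apply/is_derive_entry => i.
  rewrite (_ : (fun s => _) = (fun s => Re (w s i 0))); last first.
    by apply/funext => s; rewrite mxE.
  have [+ _] := dw t i; rewrite mul1mx.
  congr is_derive; rewrite [cplx _]lock !mxE -lock ReD Re_cplx Re_sum; congr (_ + _).
  by apply: eq_bigr => j _; rewrite ReM !mxE mul0r subr0.
exists (n%:R * Num.sqrt D) => t; apply: enorm_le => i; rewrite mxE.
by have [h _] := le_csq (w t) i; rewrite (le_trans h)// ler_wsqrtr.
Qed.

End fixed_matrix.
End real_system.

(** * Differences of translates *)

Section translates.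
Context {R : realType}.

(** Compact sets of the line lie in segments centred at 0. *)
Lemma cvg_family_compactP (F : nat -> R -> R) :
  {family compact, F @ \oo --> (fun=> 0 : R)} <->
  forall r e : R, 0 < e -> exists N, forall k, (N <= k)%N ->
    forall t, `|t| <= r -> `|F k t| < e.
Proof.
split=> [/fam_cvgP H r e e0|H].
  have cK : compact `[- r, r]%classic by exact: segment_compact.
  have /(_ [set f | forall t, `[- r, r]%classic t -> `|f t| < e])[] := H _ cK.
    apply/uniform_nbhs; exists [set xy | ball xy.1 e xy.2].
    split; first by rewrite -entourage_ballE; exists e.
    by move=> f /= fE t /fE; rewrite /ball/= sub0r normrN.
  move=> N _ HN; exists N => k Nk t tr; apply: (HN k Nk).
  by rewrite /= in_itv/= -ler_norml.
apply/fam_cvgP => K /compact_bounded[M [_ KM]] P /uniform_nbhs[E [+ EP]].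
rewrite -entourage_ballE => -[e /= e0 eE].
have [N HN] := H (M + 1) e e0.
exists N => // k /= Nk; apply: EP => t Kt; apply: eE => /=.
rewrite /ball/= sub0r normrN; apply: HN => //.
by apply: (KM (M + 1)) => //; rewrite ltrDl.
Qed.

Lemma der_shift (f : R -> R) (t c a : R) :
  is_derive (t + c) (1 : R) f a -> is_derive t (1 : R) (fun s => f (s + c)) a.
Proof.
move=> fa; rewrite -[a]mulr1; apply: (@is_derive1_comp _ f (fun s => s + c)) => //.
by have := derD (is_derive_id t 1) (is_derive_cst c t 1); rewrite addr0.
Qed.

Lemma MVT_is_derive (f df : R -> R) (a b : R) : a < b ->
  (forall s, a <= s <= b -> is_derive s (1 : R) f (df s)) ->
  exists2 c, a <= c <= b & f b - f a = df c * (b - a).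
Proof.
move=> ab fd; have [||c cab E] := @MVT_segment R f df a b (ltW ab) _ _.
- move=> s; rewrite in_itv/= => /andP[h1 h2]; apply: fd.
  by rewrite !ltW.
- apply: derivable_within_continuous => s; rewrite in_itv/= => /fd sd.
  by case: sd.
- by exists c => //; rewrite in_itv/= in cab.
Qed.

Definition mx_l1norm n (A : 'M[R]_n) : R := \sum_i \sum_j `|A i j|.

Lemma mx_l1norm_ge0 n (A : 'M[R]_n) : 0 <= mx_l1norm A.
Proof. by apply: sumr_ge0 => i _; apply: sumr_ge0. Qed.

Lemma entry_mulmx n (A : 'M[R]_n) (v : 'cV[R]_n) (r : R) i :
  (forall j, `|v j 0| <= r) -> `|(A *m v) i 0| <= mx_l1norm A * r.
Proof.
move=> vr; rewrite mxE (le_trans (ler_norm_sum _ _ _))//.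
have r0 : 0 <= r by exact: le_trans (vr i).
apply: (@le_trans _ _ (\sum_j (`|A i j| * r))).
  by apply: ler_sum => j _; rewrite normrM ler_wpM2l.
rewrite -mulr_suml ler_wpM2r// /mx_l1norm [leRHS](bigD1 i)//= lerDl.
by apply: sumr_ge0 => k _; apply: sumr_ge0.
Qed.

Section forced_system.
Variables (n : nat) (A : 'M[R]_n).

Lemma solution_lipschitz (g x : R -> 'cV[R]_n) (D B : R) : solution A g x ->
  (forall t, enorm (x t) <= D) -> (forall t, enorm (g t) <= B) ->
  exists2 K : R, 0 < K & forall i s t, `|x s i 0 - x t i 0| <= K * `|s - t|.
Proof.
move=> sx xD gB; pose K := mx_l1norm A * D + B + 1.
have D0 : 0 <= D by rewrite (le_trans (enorm_ge0 (x 0))).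
have B0 : 0 <= B by rewrite (le_trans (enorm_ge0 (g 0))).
have K0 : 0 < K by rewrite ltr_wpDl// addr_ge0// mulr_ge0// mx_l1norm_ge0.
exists K => // i.
have main s t : s < t -> `|x t i 0 - x s i 0| <= K * `|t - s|.
  move=> st.
  have [r _|c _ ->] := @MVT_is_derive (fun s => x s i 0)
      (fun s => (A *m x s + g s) i 0) s t st.
    by have /is_derive_entry := sx r; exact.
  rewrite normrM ler_wpM2r// mxE (le_trans (ler_normD _ _))//.
  rewrite /K -addrA lerD//.
    by apply: entry_mulmx => j; rewrite (le_trans (le_enorm _ _)).
  by rewrite (le_trans (le_enorm _ _))// (le_trans (gB c))// lerDl.
move=> s t; have [st|ts|->] := ltgtP s t.
- by rewrite distrC [`|s - t|]distrC main.
- exact: main.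
- by rewrite !subrr normr0 mulr0.
Qed.

(** If h were smaller than rho in all coordinates on the whole interval, the
mean value theorem would write kap G_i(c), at some c, as
h_i(u + kap) - h_i(u) - kap (A h(c))_i, which is smaller than kap e in absolute value. *)
Lemma forcing_felt (e kap : R) : 0 < e -> 0 < kap ->
  exists2 rho : R, 0 < rho & forall (h G : R -> 'cV[R]_n) u i,
    (forall s, u <= s <= u + kap -> is_derive s (1 : R) h (A *m h s + G s)) ->
    (forall s, u <= s <= u + kap -> e <= `|G s i 0|) ->
    exists s j, u <= s <= u + kap /\ rho <= `|h s j 0|.
Proof.
move=> e0 k0; pose a := mx_l1norm A; have a0 : 0 <= a by exact: mx_l1norm_ge0.
have p : 0 < 2 + kap * a by rewrite ltr_pwDl// mulr_ge0// ltW.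
(* Three evaluations of h enter: at both ends with weight 1, and at c with
   weight kap a. *)
pose rho := kap * e / (2 + kap * a).
have rho0 : 0 < rho by rewrite divr_gt0// mulr_gt0.
exists rho => // h G u i dh Ge; apply: contrapT => H.
have small s j : u <= s <= u + kap -> `|h s j 0| < rho.
  by move=> su; rewrite ltNge; apply/negP => hs; apply: H; exists s, j.
have uk : u < u + kap by rewrite ltrDl.
have [s su|c cu] := @MVT_is_derive (fun s => h s i 0)
    (fun s => (A *m h s + G s) i 0) u (u + kap) uk.
  by have /is_derive_entry := dh s su; exact.
have hu : `|h u i 0| < rho by apply: small; rewrite lexx ltW.
have hk : `|h (u + kap) i 0| < rho by apply: small; rewrite lexx ltW.
have hA : `|(A *m h c) i 0| <= a * rho.
  by apply: entry_mulmx => j; exact/ltW/small.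
have Gc := Ge c cu.
rewrite mxE [u + kap - u]addrC addKr => E.
have : `|kap * G c i 0| <= `|h (u + kap) i 0| + `|h u i 0| + `|kap * (A *m h c) i 0|.
  have -> : kap * G c i 0 = h (u + kap) i 0 - h u i 0 - kap * (A *m h c) i 0.
    by rewrite E; ring.
  by rewrite (le_trans (ler_normB _ _))// lerD2r ler_normB.
rewrite !normrM (gtr0_norm k0) => h1.
have h2 : kap * e <= kap * `|G c i 0| by rewrite ler_pM2l.
have h3 : kap * `|(A *m h c) i 0| <= kap * (a * rho) by rewrite ler_pM2l.
have h4 : kap * e = (2 + kap * a) * rho.
  by rewrite /rho; field; rewrite gt_eqF.
by lra.
Qed.

Lemma is_derive_translateB (g x : R -> 'cV[R]_n) (c t : R) : solution A g x ->
  is_derive t (1 : R) (fun s => x (s + c) - x s)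
    (A *m (x (t + c) - x t) + (g (t + c) - g t)).
Proof.
move=> sx; apply/is_derive_entry => i.
have /is_derive_entry/(_ i) d1 := sx (t + c).
have /is_derive_entry/(_ i) d2 := sx t.
rewrite (_ : (fun s => _) = (fun s => x (s + c) i 0 - x s i 0)); last first.
  by apply/funext => s; rewrite !mxE.
by apply: der_eq (derB (der_shift d1) d2) _; rewrite mulmxBr !mxE; ring.
Qed.

End forced_system.
End translates.

(** * Unpredictability and stability of the bounded solution *)

Section bounded_solutions.
Context {R : realType}.
Variables (n : nat) (hn : (0 < n)%N) (A : 'M[R]_n).

Lemma is_derive_solutionB (g x y : R -> 'cV[R]_n) (t : R) :
  is_derive t (1 : R) x (A *m x t + g t) ->
  is_derive t (1 : R) y (A *m y t + g t) ->
  is_derive t (1 : R) (fun s => x s - y s) (A *m (x t - y t)).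
Proof.
move=> dx dy; have := is_deriveB dx dy.
by rewrite mulmxBr opprD addrACA subrr addr0.
Qed.

Lemma enormB_le (v w : 'cV[R]_n) (a b : R) :
  enorm v <= a -> enorm w <= b -> enorm (v - w) <= n%:R * (a + b).
Proof.
move=> va wb; apply: enorm_le => i; rewrite !mxE (le_trans (ler_normB _ _))// lerD//.
  exact: le_trans (le_enorm _ _) va.
exact: le_trans (le_enorm _ _) wb.
Qed.

Lemma uniformly_continuous_entry (g : R -> 'cV[R]_n) :
  (forall e : R, 0 < e -> exists2 d : R, 0 < d &
    forall s t : R, `|s - t| < d -> enorm (g s - g t) < e) ->
  forall i, continuous (fun s => g s i 0).
Proof.
move=> H i t; apply/cvgrPdist_lt => e /H[d d0 gd].
near=> s.
have := le_enorm (g t - g s) i; rewrite !mxE => /le_lt_trans; apply.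
by apply: gd; near: s; exact: cvgr_dist_lt.
Unshelve. all: by end_near. Qed.

(** The times t_k of g serve x as well.  The times u_k are replaced by times s_k
between u_k and u_k + d / 2, with d a modulus of continuity of g, at which the
difference of translates is at least rho in some coordinate; it stays above
rho / 2 nearby by the Lipschitz bound. *)
Lemma unpredictable_of_bounded (g x : R -> 'cV[R]_n) (D : R) :
  (forall z, complex_eigenvalue A z -> complex.Re z != 0) ->
  unpredictable g -> solution A g x -> (forall t, enorm (x t) <= D) ->
  unpredictable x.
Proof.
move=> hA [gU [B gB] [e0 [de [t_ [u_ [[e00 de0] [ttoo utoo] gcv gsep]]]]]] sx xD.
have [K K0 xK] := solution_lipschitz sx xD gB.
have n0 : 0 < n%:R :> R by rewrite ltr0n.
split.
- move=> e epos; exists (e / (2 * (n%:R * K))).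
    by rewrite divr_gt0// !mulr_gt0.
  move=> s t st; apply: (@le_lt_trans _ _ (n%:R * (K * `|s - t|))).
    by apply: enorm_le => i; rewrite !mxE.
  rewrite mulrA -ltr_pdivlMl ?mulr_gt0// (lt_trans st)//.
  rewrite mulrC ltr_pM2r// ltf_pV2 ?posrE ?mulr_gt0//.
  by rewrite ltr_pMl ?mulr_gt0// ltr1n.
- by exists D.
(* At u_k some coordinate of the forcing is at least e0 / 2n = 4 m; it moves by
   less than 2 m within the modulus d of g for m, hence stays above 2 m. *)
pose m := e0 / (8 * n%:R); have m0 : 0 < m by rewrite divr_gt0// mulr_gt0.
have [d d0 gd] := gU m m0.
have m2 : 0 < 2 * m by rewrite mulr_gt0.
have kap0 : 0 < d / 2 by rewrite divr_gt0.
have [rho rho0 felt] := @forcing_felt R n A (2 * m) (d / 2) m2 kap0.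
have /choice[s sP] : forall k, exists v, exists j,
    u_ k <= v <= u_ k + d / 2 /\ rho <= `|(x (v + t_ k) - x v) j 0|.
  move=> k.
  have [i ui] : exists i, 4 * m <= `|(g (u_ k + t_ k) - g (u_ k)) i 0|.
    apply: contrapT => ui; have : enorm (g (u_ k + t_ k) - g (u_ k)) <= n%:R * (4 * m).
      apply: enorm_le => i; rewrite leNgt; apply/negP => /ltW h; apply: ui.
      by exists i.
    have uu : u_ k - de <= u_ k <= u_ k + de.
      by rewrite gerBl lerDl ltW.
    have -> : n%:R * (4 * m) = e0 / 2 by rewrite /m; field; rewrite gt_eqF.
    have := gsep k (u_ k) uu; lra.
  apply: (felt (fun s => x (s + t_ k) - x s) (fun s => g (s + t_ k) - g s) (u_ k) i).
    by move=> s _; exact: is_derive_translateB.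
  move=> s /andP[s1 s2].
  have close a b : `|a - b| < d -> `|g a i 0 - g b i 0| < m.
    move=> /gd; have := le_enorm (g a - g b) i; rewrite !mxE; exact: le_lt_trans.
  have sd : `|s - u_ k| < d by rewrite ger0_norm; lra.
  have h1 := close _ _ sd.
  have h2 : `|g (s + t_ k) i 0 - g (u_ k + t_ k) i 0| < m.
    by apply: close; rewrite opprD addrACA subrr addr0.
  rewrite !mxE in ui *.
  have := ler_normD (g (s + t_ k) i 0 - g s i 0)
    (- (g (s + t_ k) i 0 - g (u_ k + t_ k) i 0) + (g s i 0 - g (u_ k) i 0)).
  have := ler_normD (- (g (s + t_ k) i 0 - g (u_ k + t_ k) i 0)) (g s i 0 - g (u_ k) i 0).
  rewrite normrN; set p := (X in `|X| <= _ -> _).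
  rewrite (_ : g (s + t_ k) i 0 - g s i 0 + p = g (u_ k + t_ k) i 0 - g (u_ k) i 0).
    lra.
  by rewrite /p; ring.
exists (rho / 2), (rho / (4 * K)), t_, s; split.
- by rewrite !divr_gt0// mulr_gt0.
- split => //; apply/cvgryPge => a; move/cvgryPge/(_ a): utoo.
  apply: filterS => k /le_trans; apply.
  by have [j [/andP[]]] := sP k.
- apply/cvg_family_compactP => r r0 rpos.
  have [L [eta [L0 eta0 H]]] :=
    @system_locally_small R n hn A hA (n%:R * (D + D)) (r0 / 2)
      ltac:(by rewrite divr_gt0).
  have [N HN] := (cvg_family_compactP _).1 gcv (r + L) eta eta0.
  exists N => k Nk t tr; rewrite ger0_norm ?enorm_ge0//.
  apply: (@le_lt_trans _ _ (r0 / 2)); last by rewrite ltr_pdivrMr// ltr_pMr// ltr1n.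
  apply: (H (fun s => x (s + t_ k) - x s) (fun s => g (s + t_ k) - g s) t) => v vt.
  split; first exact: is_derive_translateB.
    exact: enormB_le.
  have := HN k Nk v; rewrite [`|enorm _|]ger0_norm ?enorm_ge0// => /(_ _)/ltW; apply.
  rewrite -(subrK t v) (le_trans (ler_normD _ _))// addrC lerD//.
  exact: ltW.
- move=> k t /andP[t1 t2]; have [j [_ hj]] := sP k.
  apply: le_trans (le_enorm _ j); rewrite !mxE in hj *.
  have h1 : `|x (t + t_ k) j 0 - x (s k + t_ k) j 0| <= rho / 4.
    rewrite (le_trans (xK _ _ _))// opprD addrACA subrr addr0.
    rewrite mulrC -ler_pdivlMr// -mulrA -invfM ler_norml.
    by apply/andP; split; lra.
  have h2 : `|x t j 0 - x (s k) j 0| <= rho / 4.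
    rewrite (le_trans (xK _ _ _))// mulrC -ler_pdivlMr// -mulrA -invfM ler_norml.
    by apply/andP; split; lra.
  have := ler_normD (x (t + t_ k) j 0 - x t j 0)
    (- (x (t + t_ k) j 0 - x (s k + t_ k) j 0) + (x t j 0 - x (s k) j 0)).
  have := ler_normD (- (x (t + t_ k) j 0 - x (s k + t_ k) j 0)) (x t j 0 - x (s k) j 0).
  rewrite normrN; set p := (X in `|X| <= _ -> _).
  rewrite (_ : x (t + t_ k) j 0 - x t j 0 + p = x (s k + t_ k) j 0 - x (s k) j 0).
    lra.
  by rewrite /p; ring.
Qed.

(** The difference of two solutions solves the homogeneous system.  Once it is
known to be bounded on [t0, +oo[, it is small at time t as soon as the window
of [system_locally_small] around t lies to the right of t0. *)
Lemma asymptotically_stable_of_neg (g x : R -> 'cV[R]_n) :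
  (forall z, complex_eigenvalue A z -> complex.Re z < 0) ->
  solution A g x -> uniformly_asymptotically_stable A g x.
Proof.
move=> hA sx; have [K K0 HK] := homogeneous_stable hn hA.
have bound t0 y : forward_solution A g t0 y -> forall t, t0 <= t ->
    enorm (y t - x t) <= K * enorm (y t0 - x t0).
  move=> [yc dy] t tt0; apply: (HK (fun t => y t - x t)) => // [i|s ts].
    under eq_fun do rewrite !mxE.
    rewrite !mxE; apply: cvgB.
      apply: (@cvg_comp _ _ _ y (fun v : 'cV[R]_n => v i 0) _ _ _ yc).
      exact: coord_continuous.
    apply: cvg_at_right_filter; have /is_derive_entry/(_ i) := sx t0.
    exact: der_cont.
  by apply: is_derive_solutionB; [exact: dy|exact: sx].
have K1 : 0 < K + 1 by rewrite ltr_wpDl.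
split.
  move=> e e0; exists (e / (K + 1)); first by rewrite divr_gt0.
  move=> t0 y fy yx t tt0; apply: le_lt_trans (bound _ _ fy _ tt0) _.
  rewrite ltr_pdivlMr// in yx; apply: le_lt_trans yx.
  by rewrite mulrC ler_wpM2l ?enorm_ge0// lerDl.
exists 1 => // e e0.
have hA0 z : complex_eigenvalue A z -> complex.Re z != 0.
  by move=> /hA z0; rewrite lt_eqF.
have [L [eta [L0 eta0 H]]] :=
  @system_locally_small R n hn A hA0 K (e / 2) ltac:(by rewrite divr_gt0).
exists L => // t0 y fy yx t tt0.
apply: (@le_lt_trans _ _ (e / 2)); last by rewrite ltr_pdivrMr// ltr_pMr// ltr1n.
apply: (H (fun t => y t - x t) (fun=> 0)) => s st.
have ts : t0 < s.
  by move: st; rewrite ltr_norml => /andP[h1 h2]; lra.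
split.
- by rewrite addr0; apply: is_derive_solutionB; [exact: fy.2|exact: sx].
- rewrite (le_trans (bound _ _ fy _ (ltW ts)))// -[leRHS]mulr1 ler_wpM2l//.
  exact: ltW.
- by rewrite /enorm big1 ?sqrtr0 ?ltW// => i _; rewrite mxE expr0n.
Qed.

End bounded_solutions.

Theorem theorem2p1 (R : realType) (n : nat) (hn : (0 < n)%N)
    (A : 'M[R]_n) (g : R -> 'cV[R]_n)
    (hA : forall z : R[i]%C, complex_eigenvalue A z -> complex.Re z != 0)
    (hg : unpredictable g) :
  (exists! x : R -> 'cV[R]_n, unpredictable_solution A g x) /\
  ((forall z : R[i]%C, complex_eigenvalue A z -> complex.Re z < 0) ->
   forall x : R -> 'cV[R]_n, unpredictable_solution A g x ->
     uniformly_asymptotically_stable A g x).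
Proof.
split; last by move=> hneg x [sx _]; exact: asymptotically_stable_of_neg.
have [gU [B gB] _] := hg.
have [x sx [D xD]] := system_bounded_solution hn hA (uniformly_continuous_entry gU) gB.
exists x; split.
  by split => //; exact: unpredictable_of_bounded hA hg sx xD.
move=> y [sy [_ [D' yD] _]]; apply/funext => t; apply/eqP; rewrite -subr_eq0; apply/eqP.
apply: (@bounded_homogeneous_eq0 R n hn A (n%:R * (D + D')) (fun s => x s - y s)) => // s.
  by apply: is_derive_solutionB; [exact: sx|exact: sy].
exact: enormB_le.
Qed.
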